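(* Let $\mathcal{X}$ be a complete separable metric space with Borel sigma field $\mathcal{S}$, let $\mu$ be a probability measure on $(\mathcal{X}, \mathcal{S})$, and let $\mathcal{C} \subseteq \mathcal{S}$. If $\mathcal{C}$ is a VC-class, then for every $\epsilon > 0$ there exists a finite measurable partition $\pi$ of $\mathcal{X}$ such that $$\sup_{C \in \mathcal{C}} \mu(\partial(C : \pi)) < \epsilon .$$
   Context: A family $\mathcal{C} \subseteq \mathcal{S}$ of measurable sets is a Vapnik-Chervonenkis (VC) class if there is a finite integer $k$ such that $|\{ C \cap D : C \in \mathcal{C} \}| < 2^k$ for every $D \subseteq \mathcal{X}$ with $|D| = k$, where $|\cdot|$ denotes cardinality. For a finite measurable partition $\pi$ of $\mathcal{X}$ and a set $C \in \mathcal{C}$, the $\pi$-boundary of $C$ is the union of all cells of $\pi$ that intersect both $C$ and its complement with positive probability: $$\partial(C : \pi) = \bigcup \{ A \in \pi : \mu(A \cap C) > 0 \text{ and } \mu(A \cap C^c) > 0 \}.$$ It depends on $\mu$, which is suppressed in the notation. *)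

(* Defs.v *)
From HB Require Import structures.
From mathcomp Require Import all_boot all_order all_algebra.
From mathcomp Require Import all_classical all_reals all_analysis.

Set Implicit Arguments.
Unset Strict Implicit.
Unset Printing Implicit Defensive.

Import Order.TTheory GRing.Theory Num.Theory.

Local Open Scope classical_set_scope.
Local Open Scope card_scope.
Local Open Scope ring_scope.

(* [Complete] requires a pointed carrier; this loses no generality for a space
   that carries a probability measure. *)
#[short(type="completeMetricType")]
HB.structure Definition CompleteMetric (R : numDomainType) :=
  {T of Complete T & Metric R T}.

Definition separable (T : topologicalType) :=
  exists2 D : set T, countable D & dense D.

Notation borelType X := (g_sigma_algebraType (@open X)).

(* Cardinals are only relational in the library, so "fewer than [2 ^ k] traces"
   reads: equipotent to [`I_m] for some [m < 2 ^ k]. *)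
Definition vc_class (T : Type) (Cs : set (set T)) :=
  exists k : nat, forall D : set T, D #= `I_k ->
    exists2 m, (m < 2 ^ k)%N & [set C `&` D | C in Cs] #= `I_m.

(* A partition is represented by the set of its cells. *)
Definition finite_measurable_partition d (T : measurableType d)
    (p : set (set T)) :=
  [/\ finite_set p, p `<=` measurable & partition p id [set: T]].

Definition pi_boundary d (T : measurableType d) (R : realType)
    (mu : {measure set T -> \bar R}) (p : set (set T)) (C : set T) : set T :=
  \bigcup_(A in [set A | [/\ p A, (0 < mu (A `&` C))%E &
                             (0 < mu (A `&` ~` C))%E]]) A.

(* Main.v *)
Require Import Defs.
From mathcomp Require Import all_boot all_order all_algebra.
From mathcomp Require Import all_classical all_reals all_analysis.

(** Call a set [A] split by [C] when [C] and its complement both meet [A] with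
    positive measure; the [pi]-boundary of [C] is the union of the cells of
    [pi] that [C] splits.

    Suppose that some [e > 0] is such that every finite measurable partition
    has a boundary of measure more than [e], for some member of the class.
    Passing to a finer partition shrinks boundaries, so the sets of members
    with a large boundary form a filter base as the partition varies; extend it
    to an ultrafilter [G] on sets. Say that [F] is avoided when [G]-almost no
    [C] splits it. Finitely many avoided sets cannot fill the space up to
    measure [e]: for [G]-almost every [C] none of them is split, whereas the
    boundary of [C] in a partition whose cells lie in one of them or outside
    their union has measure more than [e], so it must reach into one of them.
    By exhaustion ([finite_exhaustion]) there is then a set [H] of positive
    measure without avoided subsets of positive measure. For an ultrafilter,
    not being avoided means being split by [G]-almost every [C], hence any
    finitely many subsets of [H] of positive measure are split by one common
    member of the class ([unavoidable_boundary_splitting]).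

    Applying this again and again to the atoms generated inside [H] so far
    gives, for each [m], members [C_1, ..., C_m] of the class all of whose
    [2 ^ m] atoms meet [H] with positive measure ([splitting_independent]).
    This is impossible in a VC class: with one set for each subset of a
    [k]-element index set, points picked from well-chosen atoms form a
    shattered set of size [k] ([vc_class_empty_atom]). *)

Set Implicit Arguments.
Unset Strict Implicit.
Unset Printing Implicit Defensive.

Import Order.TTheory GRing.Theory Num.Theory.

Local Open Scope classical_set_scope.
Local Open Scope ring_scope.

(** * Partitions generated by finitely many sets *)

Definition signature (T : Type) (s : seq (set T)) (x : T) : bitseq :=
  [seq `[< A x >] | A <- s].

Definition atom (T : Type) (s : seq (set T)) (b : bitseq) : set T :=
  [set x | signature s x = b].

(** Indexing partitions by lists of generating sets makes common refinement
    a mere concatenation of lists. *)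
Definition atom_partition (T : Type) (s : seq (set T)) : set (set T) :=
  range (fun x => atom s (signature s x)).

Lemma atom_cons (T : Type) (A : set T) (s : seq (set T)) (a : bool)
    (b : bitseq) :
  atom (A :: s) (a :: b) = (if a then A else ~` A) `&` atom s b.
Proof.
rewrite /atom eqEsubset; split => x /=.
- case=> <- <-; split=> //.
  by case: asboolP.
- case=> Ax ->; congr cons; case: a Ax => /= Ax; first exact/asboolP.
  exact/asboolPn.
Qed.

Lemma atom_cat_sub (T : Type) (s t : seq (set T)) (x : T) :
  atom (s ++ t) (signature (s ++ t) x) `<=`
  atom s (signature s x) `&` atom t (signature t x).
Proof.
move=> y; rewrite /atom /signature /= !map_cat => /eqP.
by rewrite eqseq_cat ?size_map// => /andP[/eqP-> /eqP->].
Qed.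

Lemma atom_sub_mem (T : Type) (s : seq (set T)) (A : set T) (x : T) :
  A \in s -> A x -> atom s (signature s x) `<=` A.
Proof.
move=> As Ax y /= /eq_in_map/(_ A As) e.
by apply/asboolP; rewrite e; apply/asboolP.
Qed.

Lemma measurable_atom d (T : measurableType d) (s : seq (set T)) (b : bitseq) :
  [set` s] `<=` measurable -> measurable (atom s b).
Proof.
elim: s b => [|A s ih] [|a b] ms.
- by rewrite (_ : atom _ _ = setT)//; apply/seteqP; split.
- by rewrite (_ : atom _ _ = set0)//; apply/seteqP; split.
- by rewrite (_ : atom _ _ = set0)//; apply/seteqP; split.
- rewrite atom_cons; apply: measurableI.
    have mA : measurable A by apply: ms; rewrite /= mem_head.
    by case: a => //; exact: measurableC.
  by apply: ih => B Bs; apply: ms; rewrite /= in_cons [_ \in _]Bs orbT.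
Qed.

Lemma atom_partitionP d (T : measurableType d) (s : seq (set T)) :
  [set` s] `<=` measurable -> finite_measurable_partition (atom_partition s).
Proof.
move=> ms; split.
- (* the atoms are indexed by the signatures, bit strings of a fixed length *)
  apply: (@sub_finite_set _ _
    ((fun b : (size s).-tuple bool => atom s b) @` setT)).
    move=> _ [x _ <-]; have sz : size (signature s x) == size s.
      by rewrite size_map.
    by exists (Tuple sz).
  by apply: finite_image; exact: finite_finset.
- by move=> _ [x _ <-]; exact: measurable_atom.
- split.
  + apply/seteqP; split=> // x _.
    by exists (atom s (signature s x)) => //; exists x.
  + by move=> _ _ [x _ <-] [y _ <-] [z []]; rewrite /atom /= => -> ->.
  + by move=> _ [x _ <-]; exists x.
Qed.

(** * Splitting and boundaries *)

Definition splits d (T : measurableType d) (R : realType)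
    (mu : {measure set T -> \bar R}) (C A : set T) : Prop :=
  (0 < mu (A `&` C))%E /\ (0 < mu (A `&` ~` C))%E.

Lemma splitsS d (T : measurableType d) (R : realType)
    (mu : {measure set T -> \bar R}) (C A B : set T) :
  measurable C -> measurable A -> measurable B -> A `<=` B ->
  splits mu C A -> splits mu C B.
Proof.
move=> mC mA mB AB [h1 h2]; split.
- apply: lt_le_trans h1 _; apply: le_measure; rewrite ?inE.
  + exact: measurableI.
  + exact: measurableI.
  + exact: setSI.
- have mC' := measurableC mC; apply: lt_le_trans h2 _.
  apply: le_measure; rewrite ?inE.
  + exact: measurableI.
  + exact: measurableI.
  + exact: setSI.
Qed.

Lemma pi_boundary_atom d (T : measurableType d) (R : realType)
    (mu : {measure set T -> \bar R}) (s : seq (set T)) (C : set T) :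
  pi_boundary mu (atom_partition s) C =
  [set x | splits mu C (atom s (signature s x))].
Proof.
apply/seteqP; split=> [x [_ [[y _ <-] h1 h2] /= ->] //|x [/= h1 h2]].
by exists (atom s (signature s x)) => //; split => //; exists x.
Qed.

Lemma measurable_pi_boundary d (T : measurableType d) (R : realType)
    (mu : {measure set T -> \bar R}) (p : set (set T)) (C : set T) :
  finite_measurable_partition p -> measurable (pi_boundary mu p C).
Proof.
move=> [fp mp _]; apply: fin_bigcup_measurable => [|A [pA _ _]].
  by apply: sub_finite_set fp => A [].
exact: mp.
Qed.

(** Finer partitions have smaller boundaries: a set that splits an atom also
    splits the coarser atom around it. *)
Lemma pi_boundary_cat_sub d (T : measurableType d) (R : realType)
    (mu : {measure set T -> \bar R}) (s t : seq (set T)) (C : set T) :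
  [set` s] `<=` measurable -> [set` t] `<=` measurable -> measurable C ->
  pi_boundary mu (atom_partition (s ++ t)) C `<=`
  pi_boundary mu (atom_partition s) C `&` pi_boundary mu (atom_partition t) C.
Proof.
move=> ms mt mC; rewrite !pi_boundary_atom => x /= hx.
have mst : [set` s ++ t] `<=` measurable.
  by move=> A /=; rewrite mem_cat => /orP[/ms|/mt].
have sub := @atom_cat_sub _ s t x.
by split; apply: splitsS hx => //; try exact: measurable_atom;
  move=> y /sub[].
Qed.

(** * Independent sets in a VC class *)

(** The bound of dual shattering, exponential in the [k] of [vc_class]: index
    [2 ^ k] sets by the subsets of a [k]-element set of indices, and let [x_j]
    lie in exactly those whose index contains [j]. The set with index [S] then
    cuts out of the points [x_j] precisely those with [j] in [S], so that the
    [x_j] are shattered. *)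
Lemma vc_class_empty_atom (T : Type) (Cs : set (set T)) :
  vc_class Cs -> exists m, forall s : seq (set T),
    size s = m -> [set` s] `<=` Cs ->
    exists b : m.-tuple bool, atom s b = set0.
Proof.
move=> [k hk]; exists #|{set 'I_k}| => s sz sC; apply: contrapT => hne.
pose member (S : {set 'I_k}) := nth set0 s (enum_rank S).
have memberC S : Cs (member S).
  by apply: sC => /=; apply: mem_nth; rewrite sz.
have [x hx] : {x : 'I_k -> T & forall j S, member S (x j) <-> j \in S}.
  apply: (@choice _ _ (fun j y => forall S, member S y <-> j \in S)) => j;
  pose b := [seq j \in A | A : {set 'I_k} <- enum {set 'I_k}].
  have szb : size b == #|{set 'I_k}| by rewrite size_map -cardE.
  have /set0P[y /= yb] : atom s b != set0.
    by apply/eqP => e; apply: hne; exists (Tuple szb).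
  exists y => S.
  have lt : (enum_rank S < size s)%N by rewrite sz.
  have lt' : (enum_rank S < size (enum {set 'I_k}))%N by rewrite -cardE.
  have := congr1 (fun c => nth false c (enum_rank S)) yb.
  rewrite (nth_map set0)// (nth_map S)// nth_enum_rank => <-.
  by split => [h|/asboolP//]; apply/asboolP.
have xinj : injective x.
  by move=> i j e; apply/set1P/hx; rewrite e; apply/hx/set11.
have /hk[m ltm hm] : (range x #= `I_k)%card.
  apply: card_eq_trans (card_esym card_II).
  by apply: inj_card_eq => i j _ _; exact: xinj.
(* the traces are indexed by an ordinal, not by [{set 'I_k}], to be compared
   with [`I_m] *)
pose tr (i : 'I_#|{set 'I_k}|) := member (enum_val i) `&` range x.
have trinj : injective tr.
  move=> i j e; apply: enum_val_inj; apply/setP => l.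
  have iff S : member S (x l) <-> (member S `&` range x) (x l).
    by split=> [?|[]//]; split => //; exists l.
  by apply/idP/idP => /hx/iff h; apply/hx/iff; move: h;
    rewrite -/(tr _) ?e // -e.
have : (range tr #<= `I_m)%card.
  rewrite -(card_le_eqr hm); apply: subset_card_le => _ [i _ <-].
  by exists (member (enum_val i)).
have /card_le_eql -> : (range tr #= `I_#|{set 'I_k}|)%card.
  apply: card_eq_trans (card_esym card_II).
  by apply: inj_card_eq => i j _ _; exact: trinj.
rewrite card_le_II leqNgt -cardsT -powersetT card_powerset cardsT card_ord.
by rewrite ltm.
Qed.

(** * Exhaustion and simultaneous splitting *)

(** Exhaustion: let [a] be the supremum of the measures of finite unions of
    sets of [N], and [V] the union of a maximizing sequence of such unions. If
    [V] missed a set of positive measure, it would miss some [F] of positive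
    measure in [N], and adding [F] to a nearly optimal union would exceed [a].
    Hence [V] has full measure, so [a = 1] by continuity from below. *)
Lemma finite_exhaustion d (T : measurableType d) (R : realType)
    (mu : probability T R) (N : set (set T)) (e : R) :
  N `<=` measurable ->
  (forall H, measurable H -> (0 < mu H)%E ->
    exists F, [/\ N F, F `<=` H & (0 < mu F)%E]) ->
  0 < e ->
  exists2 s : seq (set T), [set` s] `<=` N &
    (mu (~` \bigcup_(A in [set` s]) A) < e%:E)%E.
Proof.
move=> mN hN e0; pose U (s : seq (set T)) := \bigcup_(A in [set` s]) A.
have mU s : [set` s] `<=` N -> measurable (U s).
  by move=> sN; apply: fin_bigcup_measurable => // A /sN/mN.
pose S := [set mu (U s) | s in [set s : seq (set T) | [set` s] `<=` N]].
have leS s : [set` s] `<=` N -> (mu (U s) <= ereal_sup S)%E.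
  by move=> sN; apply: ereal_sup_ubound; exists s.
have S1 : (ereal_sup S <= 1)%E.
  by apply: ge_ereal_sup => _ [s sN <-]; apply: probability_le1; exact: mU.
have Sfin : ereal_sup S \is a fin_num.
  rewrite fin_numE; apply/andP; split; apply/eqP => h.
    have /leS leS0 : [set` [::]] `<=` N by [].
    by have := le_trans (measure_ge0 mu _) leS0; rewrite h.
  by move: S1; rewrite h.
have [s hs] : {s : nat -> seq (set T) & forall n, [set` s n] `<=` N /\
    (ereal_sup S < mu (U (s n)) + (n.+1%:R^-1)%:E)%E}.
  apply: (@choice _ _ (fun n (s : seq (set T)) => [set` s] `<=` N /\
    (ereal_sup S < mu (U s) + (n.+1%:R^-1)%:E)%E)) => n.
  have n0 : 0 < n.+1%:R^-1 :> R by rewrite invr_gt0.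
  have [_ [s sN <-]] := ub_ereal_sup_adherent n0 Sfin.
  by rewrite lteBlDr// => hs; exists s.
pose V := \bigcup_n U (s n).
have mV : measurable V.
  by apply: bigcup_measurable => n _; apply: mU; exact: (hs n).1.
have muV : mu (~` V) = 0%E.
  apply/eqP; rewrite eq_le measure_ge0 andbT leNgt; apply/negP => V0.
  have [F [NF FV F0]] := hN _ (measurableC mV) V0.
  have mF := mN _ NF.
  have Ffin : mu F \is a fin_num by apply: fin_num_measure.
  have F0' : 0 < fine (mu F) by rewrite -lte_fin fineK.
  have [n _ /(_ n (leqnn n))] := near_infty_natSinv_lt (PosNum F0').
  rewrite /= -lte_fin fineK// ltNge => /negP; apply.
  have [sN hn] := hs n.
  have sFN : [set` F :: s n] `<=` N.
    by move=> A /=; rewrite in_cons => /orP[/eqP->|/sN].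
  have Ufin : mu (U (s n)) \is a fin_num by apply: fin_num_measure; exact: mU.
  have UF : U (F :: s n) = U (s n) `|` F.
    rewrite /U; apply/seteqP; split => x.
      by move=> [A /=]; rewrite in_cons => /orP[/eqP->|As Ax];
        [right|left; exists A].
    move=> [[A /= As Ax]|Fx]; last by exists F => //=; rewrite mem_head.
    by exists A => //=; rewrite in_cons As orbT.
  have := le_lt_trans (leS _ sFN) hn.
  rewrite UF measureU//; last 2 first.
  - exact: mU.
  - apply/seteqP; split => // x [Ux /FV]; apply; by exists n.
  by rewrite lteD2lE// => /ltW.
(* continuity from below needs an increasing sequence *)
pose t n := flatten [seq s i | i <- iota 0 n.+1].
have tN n : [set` t n] `<=` N.
  by move=> A /= /flatten_mapP[i _ Ai]; exact: (hs i).1.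
have UtE n : U (t n) = \bigcup_(i in [set i | (i <= n)%N]) U (s i).
  apply/seteqP; split => x.
    move=> [A /flatten_mapP[i]]; rewrite mem_iota add0n ltnS => /= li Ai Ax.
    by exists i => //; exists A.
  move=> [i /= li [A Ai Ax]]; exists A => //=.
  apply/flatten_mapP; exists i => //; by rewrite mem_iota add0n ltnS.
have VE : V = \bigcup_n U (t n).
  apply/seteqP; split => x [n _].
    by exists n => //; rewrite UtE; exists n => /=.
  by rewrite UtE => -[i _ ?]; exists i.
have cvgV : (mu \o (U \o t)) x @[x --> \oo] --> mu V.
  rewrite VE; apply: nondecreasing_cvg_mu => [n||n m nm].
  - exact: mU.
  - by rewrite -VE.
  - rewrite subsetEset /= !UtE => x [i /= li ?]; exists i => //=.
    exact: leq_trans li nm.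
have {cvgV}leV : (mu V <= ereal_sup S)%E.
  by apply: cvge_le cvgV; apply: nearW => n; exact: leS.
move: muV; rewrite probability_setC// => /eqP.
rewrite sube_eq ?fin_num_adde_defl ?fin_num_measure// add0e => /eqP V1.
have [_ [r rN <-] hr] := ub_ereal_sup_adherent e0 Sfin.
exists r => //; rewrite probability_setC; last exact: mU.
have rfin : mu (U r) \is a fin_num by apply: fin_num_measure; exact: mU.
rewrite -/(U r) lteBlDr// addeC -lteBlDr//; apply: le_lt_trans hr.
by rewrite leeD2r// V1.
Qed.

(** The substitute for shattering at the level of measure: one and the same
    [C] splits all the given subsets of [H]. *)
Definition simultaneous_splitting d (T : measurableType d) (R : realType)
    (mu : {measure set T -> \bar R}) (Cs : set (set T)) (H : set T) : Prop :=
  forall (I : finType) (F : I -> set T),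
    (forall i, [/\ measurable (F i), F i `<=` H & (0 < mu (F i))%E]) ->
    exists2 C, Cs C & forall i, splits mu C (F i).

(** The ultrafilter is what yields simultaneity: as the avoided sets are those
    that [G]-almost no [C] splits, every other measurable set is split by
    [G]-almost all [C], and finitely many such conditions hold together. *)
Lemma unavoidable_boundary_splitting d (T : measurableType d) (R : realType)
    (mu : probability T R) (Cs : set (set T)) (e : R) :
  Cs `<=` measurable -> 0 < e ->
  (forall p, finite_measurable_partition p ->
    exists2 C, Cs C & (e%:E < mu (pi_boundary mu p C))%E) ->
  exists H, [/\ measurable H, (0 < mu H)%E & simultaneous_splitting mu Cs H].
Proof.
move=> mC e0 hbd.
pose D := [set s : seq (set T) | [set` s] `<=` measurable].
pose B s := [set C | Cs C /\
  (e%:E < mu (pi_boundary mu (atom_partition s) C))%E].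
have FF : ProperFilter (filter_from D B).
  apply: filter_from_proper; last first.
    by move=> s /atom_partitionP/hbd[C CC hC]; exists C.
  apply: filter_from_filter; first by exists [::].
  move=> s t ms mt.
  have mst : D (s ++ t).
    by move=> A /=; rewrite mem_cat => /orP[/ms|/mt].
  exists (s ++ t) => // C [CC hC].
  have sub := @pi_boundary_cat_sub _ _ _ mu s t C ms mt (mC _ CC).
  split; (split => //; apply: lt_le_trans hC _; apply: le_measure; rewrite ?inE;
    [apply: measurable_pi_boundary; exact: atom_partitionP..
    |by move=> x /sub[]]).
have [G [GU subG]] := ultraFilterLemma FF.
have FG : ProperFilter G by exact: ultra_proper.
have GC : G Cs by apply: subG; exists [::] => // C [].
pose N := [set F | measurable F /\ G (~` (splits mu ^~ F))].
have [H [mH H0 hH]] : exists H, [/\ measurable H, (0 < mu H)%E &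
    forall F, N F -> F `<=` H -> ~ (0 < mu F)%E].
  apply: contrapT => nH.
  (* otherwise finitely many avoided sets [s] fill the space up to [e] *)
  have [|||s sN small] := @finite_exhaustion _ _ _ mu N e.
  - by move=> F [].
  - move=> H mH H0; apply: contrapT => nF; apply: nH; exists H; split => //.
    by move=> F NF FH F0; apply: nF; exists F.
  - by [].
  have sm : D s by move=> F /sN[].
  have Gs : G [set C | forall F, F \in s -> ~ splits mu C F].
    elim: s sN {small sm} => [|F s ih] sN; first exact: filterE.
    have [_ GF] := sN F (mem_head _ _).
    have GT : G [set C | forall F, F \in s -> ~ splits mu C F].
      by apply: ih => A As; apply: sN; rewrite /= in_cons [_ \in _]As orbT.
    apply: filterS2 GF GT => C CF Cs' A.
    by rewrite in_cons => /orP[/eqP->|/Cs'].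
  have GB : G (B s) by apply: subG; exists s.
  have [C [[CC hC] nC]] := filter_ex (filterI GB Gs).
  have := lt_trans small hC; rewrite ltNge => /negP; apply.
  apply: le_measure; rewrite ?inE.
  - by apply: measurable_pi_boundary; exact: atom_partitionP.
  - by apply: measurableC; apply: fin_bigcup_measurable.
  (* an atom that meets a set of [s] lies inside it: if [C] splits the atom, it
     splits that set too *)
  rewrite pi_boundary_atom => x /= hx [A As Ax].
  apply: (nC A As); apply: splitsS hx => //.
  - exact: mC.
  - exact: measurable_atom.
  - exact: sm.
  - exact: atom_sub_mem.
exists H; split => // I F hF.
have GF : \forall C \near G, forall i, splits mu C (F i).
  apply: filter_forall => i; have [mF FH F0] := hF i.
  case: (in_ultra_setVsetC (splits mu ^~ (F i)) GU) => // GnF.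
  by case: (hH (F i)).
by have [C []] := filter_ex (filterI GC GF); exists C.
Qed.

(** Induction on [m]: the next set splits the [2 ^ m] atoms of the previous
    ones inside [H] all at once. *)
Lemma splitting_independent d (T : measurableType d) (R : realType)
    (mu : {measure set T -> \bar R}) (Cs : set (set T)) (H : set T) (m : nat) :
  Cs `<=` measurable -> measurable H -> (0 < mu H)%E ->
  simultaneous_splitting mu Cs H ->
  exists s : seq (set T), [/\ size s = m, [set` s] `<=` Cs &
    forall b : m.-tuple bool, (0 < mu (H `&` atom s b))%E].
Proof.
move=> mC mH H0 hH; elim: m => [|m [s [sz sC pos]]].
  exists [::]; split => // b; rewrite tuple0 /=.
  by rewrite (_ : H `&` _ = H)//; apply/seteqP; split => // x [].
have [|C CC hC] := hH _ (fun b : m.-tuple bool => H `&` atom s b).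
  move=> b; split => //; apply: measurableI => //.
  by apply: measurable_atom => A /sC/mC.
exists (C :: s); split => [|A|b]; first by rewrite /= sz.
- by rewrite /= in_cons => /orP[/eqP->|/sC].
- case/tupleP: b => a b /=; rewrite atom_cons setICA setIC.
  by have [h1 h2] := hC b; case: a.
Qed.

(** * Small boundaries *)

Lemma vc_class_small_boundary d (T : measurableType d) (R : realType)
    (mu : probability T R) (Cs : set (set T)) (eps : R) :
  Cs `<=` measurable -> vc_class Cs -> 0 < eps ->
  exists p : set (set T), finite_measurable_partition p /\
    (ereal_sup [set mu (pi_boundary mu p C) | C in Cs] < eps%:E)%E.
Proof.
move=> mC /vc_class_empty_atom[m vc] eps0; apply: contrapT => np.
(* halving [eps] keeps the supremum strictly below [eps] *)
have [||H [mH H0 hH]] :=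
    @unavoidable_boundary_splitting _ _ _ mu Cs (eps / 2) mC.
- by rewrite divr_gt0.
- move=> p hp; apply: contrapT => nC; apply: np; exists p; split => //.
  apply: (@le_lt_trans _ _ (eps / 2)%:E); last first.
    by rewrite lte_fin ltr_pdivrMr// ltr_pMr// ltr1n.
  apply: ge_ereal_sup => _ [C CC <-]; rewrite leNgt; apply/negP => h.
  by apply: nC; exists C.
have [s [sz sC pos]] := @splitting_independent _ _ _ mu Cs H m mC mH H0 hH.
have [b b0] := vc s sz sC.
by have := pos b; rewrite b0 setI0 measure0 ltxx.
Qed.

Theorem theorem1 (R : realType) (X : completeMetricType R)
    (hX : separable X)
    (mu : probability (borelType X) R)
    (Cs : set (set (borelType X)))
    (hCs : Cs `<=` measurable)
    (hVC : vc_class Cs)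
    (eps : R) (heps : 0 < eps) :
  exists p : set (set (borelType X)),
    finite_measurable_partition p /\
    (ereal_sup [set mu (pi_boundary mu p C) | C in Cs] < eps%:E)%E.
Proof. exact: vc_class_small_boundary. Qed.
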